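(* Let $E$ be an $n$-dimensional complex evolution algebra with matrix $A=(a_{ij})_{1\le i,j\le n}$ in a natural basis $\{e_1,\dots,e_n\}$, and suppose $\det A\neq 0$. Then $\mathrm{Aut}(E)$ (in the sense given in the context) is exactly the set of the matrices $T_\pi$, $\pi\in S_n$, where $T_\pi$ denotes any matrix $(t_{ij})_{1\le i,j\le n}$ such that $t_{ij}\neq0$ if and only if $j=\pi(i)$. Moreover, if $T_\pi=(t_{ij})\in \mathrm{Aut}(E)$ and $B=(b_{ij})_{1\le i,j\le n}$ is the matrix of $E$ in the basis $T_\pi(e_1),\dots,T_\pi(e_n)$, then $$b_{ij}=\frac{t_{i,\pi(i)}^2}{t_{j,\pi(j)}}\, a_{\pi(i)\pi(j)}\qquad\text{for all } 1\le i,j\le n .$$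
   Context: An evolution algebra over a field $K$ is a vector space $E$ over $K$ with a bilinear multiplication and a basis $\{e_1,e_2,\dots\}$ (called a natural basis) such that $e_ie_j=0$ for $i\neq j$ and $e_ie_i=\sum_k a_{ik}e_k$; here $K=\mathbb{C}$. The matrix $A=(a_{ij})_{i,j=1}^n$ is called the matrix of $E$ in the natural basis $\{e_1,\dots,e_n\}$. A matrix $T=(t_{ij})$ acts by $T(e_i)=\sum_{j=1}^n t_{ij}e_j$. In this paper, a non-singular linear transformation $T$ is regarded as an isomorphism (an element of $\mathrm{Aut}(E)$) if and only if it takes the given natural basis to a natural basis of $E$, i.e. $f_i=T(e_i)$ satisfy $f_if_j=0$ for all $i\neq j$ (it is not required that $T$ preserve the multiplication). $S_n$ is the symmetric group on $\{1,\dots,n\}$. *)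

(* Defs.v *)
From HB Require Import structures.
From mathcomp Require Import all_boot all_order all_fingroup all_algebra.
From mathcomp Require Export reals.
From mathcomp Require Export complex.

Set Implicit Arguments.
Unset Strict Implicit.
Unset Printing Implicit Defensive.

Import GRing.Theory.
Local Open Scope ring_scope.

Section EvolutionAlgebra.
Variables (K : fieldType) (E : vectType K) (n : nat).

Definition natural_basis (mul : {bilinear E -> E -> E}) (e : n.-tuple E) :
    Prop :=
  basis_of fullv e /\
  forall i j : 'I_n, i != j -> mul (tnth e i) (tnth e j) = 0.

(* The coordinates of the square of e_i are in row i; see evolution_matrixP. *)
Definition evolution_matrix (mul : {bilinear E -> E -> E}) (e : n.-tuple E) :
    'M[K]_n :=
  \matrix_(i, k) coord e k (mul (tnth e i) (tnth e i)).

Lemma evolution_matrixP (mul : {bilinear E -> E -> E}) (e : n.-tuple E)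
    (i : 'I_n) :
  basis_of fullv e ->
  mul (tnth e i) (tnth e i) =
    \sum_k evolution_matrix mul e i k *: tnth e k.
Proof.
move=> be; rewrite [LHS](coord_basis be) ?memvf //.
by apply: eq_bigr => k _; rewrite mxE -tnth_nth.
Qed.

(* A matrix acts by rows, e_i |-> \sum_j T i j *: e_j; see mx_endoE. *)
Definition mx_endo_fun (e : n.-tuple E) (T : 'M[K]_n) (v : E) : E :=
  \sum_i coord e i v *: \sum_j T i j *: tnth e j.

Fact mx_endo_fun_is_linear (e : n.-tuple E) (T : 'M[K]_n) :
  linear (mx_endo_fun e T).
Proof.
move=> a u v; rewrite /mx_endo_fun scaler_sumr -big_split /=.
by apply: eq_bigr => i _; rewrite linearP scalerDl scalerA.
Qed.

HB.instance Definition _ (e : n.-tuple E) (T : 'M[K]_n) :=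
  GRing.isSemilinear.Build K E E _ (mx_endo_fun e T)
    (GRing.semilinear_linear (mx_endo_fun_is_linear e T)).

Definition mx_endo (e : n.-tuple E) (T : 'M[K]_n) : 'End(E) :=
  linfun (mx_endo_fun e T).

Lemma mx_endoE (e : n.-tuple E) (T : 'M[K]_n) (i : 'I_n) :
  basis_of fullv e ->
  mx_endo e T (tnth e i) = \sum_j T i j *: tnth e j.
Proof.
move=> be; rewrite lfunE /= /mx_endo_fun (bigD1 i) //=.
have coord_e k : coord e k (tnth e i) = (i == k)%:R.
  by rewrite (tnth_nth 0) coord_free ?(basis_free be).
rewrite coord_e eqxx scale1r [X in _ + X]big1 ?addr0 // => k ki.
by rewrite coord_e eq_sym (negPf ki) scale0r.
Qed.

(* Aut(E) relative to the natural basis e; f need not preserve the product. *)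
Definition evolution_aut (mul : {bilinear E -> E -> E}) (e : n.-tuple E)
    (f : 'End(E)) : Prop :=
  lker f == 0%VS /\ natural_basis mul (map_tuple f e).

(* T is one of the matrices written T_pi. *)
Definition supported_on (pi : 'S_n) (T : 'M[K]_n) : Prop :=
  forall i j : 'I_n, T i j != 0 <-> j = pi i.

End EvolutionAlgebra.

(* Main.v *)
Require Import Defs.
From mathcomp Require Import all_boot all_order all_fingroup all_algebra.

(** Write f_i = T(e_i) = sum_k t_ik e_k.  Since distinct natural basis vectors
    annihilate each other, f_i f_j = sum_k t_ik t_jk e_k^2
    ([natural_basis_mulE]).  The coordinates of the squares e_k^2 are the rows
    of A, so a nonzero determinant makes these squares linearly independent
    ([evolution_squares_free]).  Hence f_i f_j = 0 for all distinct i and j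
    exactly when t_ik t_jk = 0 for all k, that is, when each column of T has at
    most one nonzero entry.  As T is injective, no row of T is zero; picking a
    nonzero entry in each row defines an injection, hence a permutation pi, and
    by the column condition there are no other nonzero entries
    ([supported_onP]).

    Conversely, if T is supported on pi then f_i = t_(i, pi i) e_(pi i): the
    f_i are nonzero multiples of the e_j in another order, so they form a
    natural basis.  Expanding f_i^2 = t_(i, pi i)^2 e_(pi i)^2 along the e_(pi j)
    and rescaling each of them to f_j gives the matrix in the new basis.

    The argument works over every field. *)

Set Implicit Arguments.
Unset Strict Implicit.
Unset Printing Implicit Defensive.

Import GRing.Theory.
Local Open Scope ring_scope.
Local Open Scope complex_scope.

Section EvolutionAlgebraTheory.
Variables (K : fieldType) (E : vectType K) (n : nat).
Implicit Types (mul : {bilinear E -> E -> E}) (e : n.-tuple E).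
Implicit Types (T : 'M[K]_n) (pi : 'S_n).

Lemma coord_sum_tnth e (c : 'I_n -> K) j :
  free e -> coord e j (\sum_k c k *: tnth e k) = c j.
Proof.
move=> fe; rewrite -[RHS](coord_sum_free _ _ fe); congr (coord _ _ _).
by apply: eq_bigr => k _; rewrite (tnth_nth 0).
Qed.

Lemma natural_basis_mulE mul e (c d : 'I_n -> K) :
  natural_basis mul e ->
  mul (\sum_k c k *: tnth e k) (\sum_k d k *: tnth e k) =
    \sum_k (c k * d k) *: mul (tnth e k) (tnth e k).
Proof.
case=> _ mul_e; rewrite linear_sumlz; apply: eq_bigr => k _.
rewrite linear_sumr (bigD1 k) //= big1 ?addr0 => [|l lk].
  by rewrite linearZl_LR linearZr_LR scalerA.
by rewrite linearZl_LR linearZr_LR mul_e ?scaler0 // eq_sym.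
Qed.

Lemma evolution_squares_free mul e (c : 'I_n -> K) :
  basis_of fullv e -> \det (evolution_matrix mul e) != 0 ->
  \sum_k c k *: mul (tnth e k) (tnth e k) = 0 -> forall k, c k = 0.
Proof.
move=> be detA sum0 k.
have uA : evolution_matrix mul e \in unitmx by rewrite unitmxE unitfE.
(* The vanishing combination says that the row vector c is killed by A. *)
have cA0 : (\row_l c l) *m evolution_matrix mul e = 0.
  apply/rowP=> j; rewrite !mxE -[RHS](linear0 (coord e j)) -sum0 linear_sum.
  by apply: eq_bigr => l _; rewrite !mxE linearZ.
have := congr1 (mulmx^~ (invmx (evolution_matrix mul e))) cA0.
by rewrite mulmxK // mul0mx => /rowP/(_ k); rewrite !mxE.
Qed.

(** A matrix with no zero row and at most one nonzero entry in each column is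
    supported on a permutation: finiteness of the index set turns the injective
    choice of a nonzero entry in each row into a bijection. *)
Lemma supported_onP T :
  (forall i, exists k, T i k != 0) ->
  (forall i j k, i != j -> T i k * T j k = 0) ->
  exists pi : 'S_n, supported_on pi T.
Proof.
move=> row_neq0 colP; pose p i := xchoose (row_neq0 i).
have Tp i : T i (p i) != 0 by exact: (xchooseP (row_neq0 i)).
have col_inj i j k : T i k != 0 -> T j k != 0 -> i = j.
  move=> Ti Tj; apply/eqP/idPn => ij; have /eqP := colP _ _ k ij.
  by rewrite mulf_eq0 (negPf Ti) (negPf Tj).
have p_inj : injective p.
  by move=> i j pij; apply: (col_inj _ _ (p i)); rewrite // pij.
exists (perm p_inj) => i j; rewrite permE; split=> [Tij | -> //].
have [q _ pK] := injF_bij p_inj.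
by rewrite -(pK j) (col_inj i (q j) j) // -{2}(pK j).
Qed.

Lemma evolution_aut_supported_on mul e T :
  natural_basis mul e -> \det (evolution_matrix mul e) != 0 ->
  evolution_aut mul e (mx_endo e T) -> exists pi : 'S_n, supported_on pi T.
Proof.
move=> nat_e detA [/lker0P injT [_ mulT]]; have be := nat_e.1.
apply: supported_onP => [i|i j k ij].
  apply/existsP; apply: contraT => /existsPn T0; have ei0 : tnth e i = 0.
    apply: injT; rewrite linear0 mx_endoE // big1 // => k _.
    by move: (T0 k); rewrite negbK => /eqP ->; rewrite scale0r.
  by have := free_not0 (basis_free be) (mem_tnth i e); rewrite ei0 eqxx.
have := mulT _ _ ij; rewrite !tnth_map !mx_endoE // natural_basis_mulE //.
by move/(evolution_squares_free be detA).
Qed.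

Lemma mx_endo_supportedE e T pi i :
  basis_of fullv e -> supported_on pi T ->
  mx_endo e T (tnth e i) = T i (pi i) *: tnth e (pi i).
Proof.
move=> be sT; rewrite mx_endoE // (bigD1 (pi i)) //= big1 ?addr0 // => k ki.
have [->|/sT ki'] := eqVneq (T i k) 0; first by rewrite scale0r.
by rewrite ki' eqxx in ki.
Qed.

Lemma supported_on_evolution_aut mul e T pi :
  natural_basis mul e -> supported_on pi T ->
  evolution_aut mul e (mx_endo e T).
Proof.
move=> [be mul_e] sT; have fe := basis_free be.
have fE i := mx_endo_supportedE i be sT.
have kerT : lker (mx_endo e T) == 0%VS.
  rewrite -subv0; apply/subvP=> v; rewrite memv_ker memv0 => /eqP Tv0.
  (* The coordinate of T v along e_(pi i) is t_(i, pi i) times that of v along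
     e_i, so all the coordinates of v vanish. *)
  have v_i0 i : coord e i v = 0.
    have := congr1 (coord e (pi i)) Tv0; rewrite linear0.
    rewrite {1}(coord_basis be (memvf v)) linear_sum.
    under eq_bigr => k _ do rewrite linearZ -tnth_nth /= fE scalerA.
    rewrite (reindex_perm pi^-1) /=.
    under eq_bigr => k _ do rewrite permKV.
    rewrite coord_sum_tnth // permK => /eqP; rewrite mulf_eq0.
    by have /negPf -> : T i (pi i) != 0; [apply/sT | rewrite orbF => /eqP].
  rewrite (coord_basis be (memvf v)) big1 // => i _.
  by rewrite v_i0 scale0r.
split=> //; split.
  rewrite -(lker0_limgf kerT).
  by apply: (limg_basis_of _ be); rewrite (eqP kerT) capv0.
move=> i j ij; rewrite !tnth_map !fE linearZl_LR linearZr_LR mul_e ?scaler0 //.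
by rewrite (inj_eq perm_inj).
Qed.

Lemma evolution_matrix_supported mul e T pi i j :
  natural_basis mul e -> supported_on pi T ->
  evolution_matrix mul (map_tuple (mx_endo e T) e) i j =
    T i (pi i) ^+ 2 / T j (pi j) * evolution_matrix mul e (pi i) (pi j).
Proof.
move=> nat_e sT; have be := nat_e.1.
have [_ [bf _]] := supported_on_evolution_aut nat_e sT.
have fE k : tnth (map_tuple (mx_endo e T) e) k = T k (pi k) *: tnth e (pi k).
  by rewrite tnth_map (mx_endo_supportedE _ be sT).
pose b k := T i (pi i) ^+ 2 / T k (pi k) * evolution_matrix mul e (pi i) (pi k).
rewrite mxE -[RHS](coord_sum_tnth b j (basis_free bf)); congr (coord _ _ _).
rewrite fE linearZl_LR linearZr_LR scalerA -expr2 evolution_matrixP //.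
rewrite (reindex_perm pi) /= scaler_sumr; apply: eq_bigr => k _.
have Tk : T k (pi k) != 0 by apply/sT.
by rewrite fE !scalerA /b [in RHS]mulrAC divfK.
Qed.

End EvolutionAlgebraTheory.

Theorem proposition3p1 (R : realType) (n : nat) (E : vectType R[i])
    (mul : {bilinear E -> E -> E}) (e : n.-tuple E) (A : 'M[R[i]]_n)
    (e_natural : natural_basis mul e) (A_def : A = evolution_matrix mul e)
    (detA_neq0 : \det A != 0) :
  (forall T : 'M[R[i]]_n,
     evolution_aut mul e (mx_endo e T) <->
     exists pi : 'S_n, supported_on pi T) /\
  (forall (pi : 'S_n) (T B : 'M[R[i]]_n),
     supported_on pi T ->
     evolution_aut mul e (mx_endo e T) ->
     B = evolution_matrix mul (map_tuple (mx_endo e T) e) ->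
     forall i j : 'I_n,
       B i j = T i (pi i) ^+ 2 / T j (pi j) * A (pi i) (pi j)).
Proof.
rewrite A_def in detA_neq0 *; split=> [T|pi T B sT _ -> i j].
  split; first exact: evolution_aut_supported_on.
  by case=> pi sT; apply: supported_on_evolution_aut sT.
exact: evolution_matrix_supported.
Qed.
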